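(* Let $\mathcal{H}$ be a separable infinite-dimensional (real) Hilbert space, $\ell\in\mathbb{N}$, $y\in\mathbb{R}^{\ell}$, and let $\mathcal{F}\colon\mathcal{H}\to\mathbb{R}^{\ell}$ be linear and continuous. Let $\lambda\ge 0$ be the regularization parameter, $F_0\in\mathcal{H}$ the initial approximation, and let the dictionary $\mathcal{D}\subset\mathcal{H}\setminus\{0\}$ satisfy the following properties: 1. (semi-frame condition) There exist a constant $c>0$ and an integer $M\in\mathbb{N}$ such that, for all expansions $H=\sum_{k=1}^\infty\beta_k d_k$ with $\beta_k\in\mathbb{R}$ and $d_k\in\mathcal{D}$, where the $d_k$ are not necessarily pairwise distinct but $|\{j\in\mathbb{N}\mid d_j=d_k\}|\le M$ for each $k\in\mathbb{N}$, the inequality $c\|H\|_{\mathcal{H}}^2\le\sum_{k=1}^\infty\beta_k^2$ is valid. 2. $C_1:=\inf_{d\in\mathcal{D}}\left(\|\mathcal{F}d\|_{\mathbb{R}^{\ell}}^2+\lambda\|d\|_{\mathcal{H}}^2\right)>0$. If the sequence $(F_n)_n$ (with chosen dictionary elements $(d_n)_{n\ge1}$ and coefficients $(\alpha_n)_{n\ge 1}$) is produced by the RFMP and no dictionary element is chosen more than $M$ times, then $(F_n)_n$ converges in $\mathcal{H}$ to $F_\infty:=\sum_{k=1}^\infty\alpha_k d_k+F_0\in\mathcal{H}$. Moreover, the following holds true: (a) If $\overline{\operatorname{span}\mathcal{D}}^{\|\cdot\|_{\mathcal{H}}}=\mathcal{H}$, if $\mathcal{D}$ is bounded (i.e. $C_2:=\sup_{d\in\mathcal{D}}\|d\|_{\mathcal{H}}<+\infty$),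 and $\lambda\ge 0$ is an arbitrary parameter, then $F_\infty$ solves the Tikhonov-regularized normal equation $$(\mathcal{F}^\ast\mathcal{F}+\lambda\mathcal{I})F_\infty=\mathcal{F}^\ast y,$$ where $\mathcal{F}^\ast$ is the adjoint operator of $\mathcal{F}$ and $\mathcal{I}$ is the identity operator on $\mathcal{H}$. This also yields that $$\|y-\mathcal{F}F_\infty\|_{\mathbb{R}^{\ell}}^2+\lambda\|F_\infty\|_{\mathcal{H}}^2=\min_{F\in\mathcal{H}}\left(\|y-\mathcal{F}F\|_{\mathbb{R}^{\ell}}^2+\lambda\|F\|_{\mathcal{H}}^2\right),$$ where the minimizer is unique if $\lambda>0$. (b) If $\operatorname{span}\{\mathcal{F}d\mid d\in\mathcal{D}\}=\operatorname{ran}\mathcal{F}$ and $\lambda=0$, then $F_\infty$ solves $\mathcal{F}F_\infty=\mathcal{P}_{\operatorname{ran}\mathcal{F}}\,y$, where $\mathcal{P}_{\operatorname{ran}\mathcal{F}}$ is the orthogonal projection of $\mathbb{R}^{\ell}$ onto $\operatorname{ran}\mathcal{F}$.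
   Context: Regularized Functional Matching Pursuit (RFMP). Given a Hilbert space $\mathcal{H}$, a continuous linear operator $\mathcal{F}\colon\mathcal{H}\to\mathbb{R}^{\ell}$, data $y\in\mathbb{R}^{\ell}$, an initial approximation $F_0\in\mathcal{H}$, a dictionary $\mathcal{D}\subset\mathcal{H}\setminus\{0\}$ and a regularization parameter $\lambda\ge0$, the RFMP sets $R^0:=y-\mathcal{F}F_0$ and, for $n=0,1,2,\dots$ (without stopping), determines $$d_{n+1}:=\operatorname*{arg\,max}_{d\in\mathcal{D}}\frac{\left(\langle R^n,\mathcal{F}d\rangle_{\mathbb{R}^{\ell}}-\lambda\langle F_n,d\rangle_{\mathcal{H}}\right)^2}{\|\mathcal{F}d\|_{\mathbb{R}^{\ell}}^2+\lambda\|d\|_{\mathcal{H}}^2},\qquad \alpha_{n+1}:=\frac{\langle R^n,\mathcal{F}d_{n+1}\rangle_{\mathbb{R}^{\ell}}-\lambda\langle F_n,d_{n+1}\rangle_{\mathcal{H}}}{\|\mathcal{F}d_{n+1}\|_{\mathbb{R}^{\ell}}^2+\lambda\|d_{n+1}\|_{\mathcal{H}}^2},$$ and sets $F_{n+1}:=F_n+\alpha_{n+1}d_{n+1}$, $R^{n+1}:=R^n-\alpha_{n+1}\mathcal{F}d_{n+1}$. Here $d_{n+1}$ denotes a maximizer over $\mathcal{D}$. ''No dictionary element is chosen more than $M$ times'' means that for each $d\in\mathcal{D}$ there are at most $M$ indices $n\ge1$ with $d_n=d$, where $M$ is the integer of the semi-frame condition. $\operatorname{ran}\mathcal{F}$ is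 the range of $\mathcal{F}$. $\mathbb{R}^{\ell}$ carries the Euclidean inner product. *)

(* Defs.v *)
From HB Require Import structures.
From mathcomp Require Import all_boot all_order all_algebra.
From mathcomp Require Import all_classical all_reals all_analysis.

Set Implicit Arguments.
Unset Strict Implicit.
Unset Printing Implicit Defensive.

Import Order.TTheory GRing.Theory Num.Theory.
Import numFieldNormedType.Exports.

Local Open Scope card_scope.
Local Open Scope classical_set_scope.
Local Open Scope ring_scope.

(** A real Hilbert space is rendered as a complete normed module [H] together
    with a positive definite symmetric bilinear form [ip : {dot H for idfun}]
    that induces the norm of [H]. *)
Definition induces_norm (R : realType) (H : normedModType R)
    (ip : {dot H for (@idfun R)}) : Prop :=
  forall x : H, ip x x = `|x| ^+ 2.

Definition separable (H : topologicalType) : Prop :=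
  exists S : set H, countable S /\ dense S.

Definition lspan (R : realType) (V : lmodType R) (D : set V) : set V :=
  [set x | exists (n : nat) (a : 'I_n -> R) (e : 'I_n -> V),
     (forall i, D (e i)) /\ x = \sum_(i < n) a i *: e i].

Definition infinite_dimensional (R : realType) (V : lmodType R) : Prop :=
  forall S : set V, finite_set S -> lspan S <> [set: V].

(** The library norm [`|_|] on ['rV_l] is the sup norm, so the Euclidean
    structure is given separately.  The topology of ['rV_l] is the product
    topology, i.e. the Euclidean one. *)
Definition edot (R : realType) (l : nat) (u v : 'rV[R]_l) : R :=
  \sum_(i < l) u 0 i * v 0 i.

Definition enorm (R : realType) (l : nat) (v : 'rV[R]_l) : R :=
  Num.sqrt (edot v v).

Definition is_adjoint (R : realType) (l : nat) (H : completeNormedModType R)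
    (ip : {dot H for (@idfun R)}) (T : H -> 'rV[R]_l) (G : 'rV[R]_l -> H) :=
  forall (x : H) (v : 'rV[R]_l), edot (T x) v = ip x (G v).

(** The adjoint is the unique [G] with [is_adjoint ip T G]; for [T] linear and
    continuous on a Hilbert space it exists by the Riesz theorem, so the default
    value of [xget] is then irrelevant. *)
Definition adjoint (R : realType) (l : nat) (H : completeNormedModType R)
    (ip : {dot H for (@idfun R)}) (T : H -> 'rV[R]_l) : 'rV[R]_l -> H :=
  xget (fun=> 0) [set G | is_adjoint ip T G].

Definition is_orth_proj (R : realType) (l : nat) (V : set 'rV[R]_l)
    (y p : 'rV[R]_l) : Prop :=
  V p /\ forall v, V v -> edot (y - p) v = 0.

(** Meaningful for [V] a linear subspace of R^l, where the orthogonal projection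
    exists and is unique. *)
Definition orth_proj (R : realType) (l : nat) (V : set 'rV[R]_l)
    (y : 'rV[R]_l) : 'rV[R]_l :=
  xget 0 [set p | is_orth_proj V y p].

(** Sequences are indexed from 0 here.  The sum of squares is taken in [\bar R]:
    the inequality holds trivially when it diverges.  [A #<= `I_M] means that
    [A] has at most [M] elements. *)
Definition semi_frame (R : realType) (H : normedModType R) (D : set H)
    (c : R) (M : nat) : Prop :=
  forall (beta : nat -> R) (e : nat -> H) (x : H),
    (forall k, D (e k)) ->
    (forall k, [set j | e j = e k] #<= `I_M) ->
    series (fun k => beta k *: e k) @ \oo --> x ->
    ((c * `|x| ^+ 2)%:E <= \sum_(0 <= k <oo) (beta k ^+ 2)%:E)%E.

Section RFMP.
Context (R : realType) (l : nat) (H : completeNormedModType R).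
Variables (ip : {dot H for (@idfun R)}) (T : H -> 'rV[R]_l) (lambda : R).

Definition rfmp_num (r : 'rV[R]_l) (f d : H) : R :=
  edot r (T d) - lambda * ip f d.

Definition rfmp_den (d : H) : R := enorm (T d) ^+ 2 + lambda * `|d| ^+ 2.

(** The values [d 0] and [alpha 0] are unused: [d n.+1] and [alpha n.+1] are the
    element and the coefficient chosen in step [n]. *)
Record rfmp (D : set H) (y : 'rV[R]_l) (F0 : H) (F : nat -> H)
    (res : nat -> 'rV[R]_l) (d : nat -> H) (alpha : nat -> R) : Prop := Rfmp {
  rfmp_F0 : F 0%N = F0 ;
  rfmp_res0 : res 0%N = y - T F0 ;
  rfmp_dict : forall n, D (d n.+1) ;
  rfmp_max : forall n e, D e ->
    rfmp_num (res n) (F n) e ^+ 2 / rfmp_den e <=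
    rfmp_num (res n) (F n) (d n.+1) ^+ 2 / rfmp_den (d n.+1) ;
  rfmp_alpha : forall n,
    alpha n.+1 = rfmp_num (res n) (F n) (d n.+1) / rfmp_den (d n.+1) ;
  rfmp_FS : forall n, F n.+1 = F n + alpha n.+1 *: d n.+1 ;
  rfmp_resS : forall n, res n.+1 = res n - alpha n.+1 *: T (d n.+1)
}.

Definition tikhonov (y : 'rV[R]_l) (f : H) : R :=
  enorm (y - T f) ^+ 2 + lambda * `|f| ^+ 2.

End RFMP.

(* Main.v *)
Require Import Defs.
From HB Require Import structures.
From mathcomp Require Import all_boot all_order all_algebra.
From mathcomp Require Import all_classical all_reals all_analysis.
From mathcomp Require Import ring lra zify.

Set Implicit Arguments.
Unset Strict Implicit.
Unset Printing Implicit Defensive.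

Import Order.TTheory GRing.Theory Num.Theory.
Import numFieldNormedType.Exports.

Local Open Scope card_scope.
Local Open Scope classical_set_scope.
Local Open Scope ring_scope.

(** The method is a greedy descent for the Tikhonov functional
    [J f = |y - T f|^2 + lambda |f|^2].  Write [num f] for the linear form
    [<y - T f, T _> - lambda <f, _>] and [den] for the quadratic form
    [|T _|^2 + lambda |_|^2].  Then
      [J (f + g) = J f - 2 num f g + den g]   (lemma [tikhonovD]),
    so [- num f] is half the derivative of [J] at [f].  Step [n] minimizes [J]
    exactly on the line through [F n] in the direction [d n.+1], and lowers it by
    [num^2 / den = alpha^2 den] (lemma [rfmp_gain]).

    Convergence.  As [den >= C > 0] on the dictionary and [J >= 0], the squares
    of the coefficients are summable.  A difference of two partial sums of the
    expansion is itself an expansion, with all other coefficients zero, so the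
    semi-frame condition bounds its squared norm by a tail of that series
    (lemmas [semi_frame_sum] and [rfmp_series_cvg]).

    Limit.  For [e] in the dictionary, the choice of [d n.+1] gives
    [num (F n) e ^+ 2 / den e <= J (F n) - J (F n.+1)], whose right-hand side
    tends to 0; hence [num Finf e = 0] (lemma [rfmp_limit_num]).  If the
    dictionary spans a dense subspace, [num Finf] vanishes everywhere.  This is
    the normal equation tested against every vector, and [tikhonovD] then reads
    [J (Finf + g) = J Finf + den g], which gives minimality, and uniqueness for
    [lambda > 0].  If [lambda = 0] and the images of the dictionary span the
    range of [T], the equations [num Finf e = 0] say that [y - T Finf] is
    orthogonal to that range.

    The adjoint of [T] is obtained from the Riesz representation theorem, proved
    by minimizing [<x, x> - 2 f x] (lemma [riesz]). *)

(** * Real Hilbert spaces *)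

Lemma cvgn_sqr_cauchy (R : realType) (V : completeNormedModType R)
    (u : nat -> V) :
  (forall e, 0 < e -> exists N, forall m, (N <= m)%N ->
     `|u m - u N| ^+ 2 <= e) ->
  cvgn u.
Proof.
move=> u_cauchy; apply/cauchy_cvgP/cauchyP => e e0.
have [N uN] := u_cauchy ((e / 2) ^+ 2) ltac:(by rewrite exprn_gt0 ?divr_gt0).
exists (u N); exists N => // m /= Nm.
rewrite -ball_normE /= distrC (@le_lt_trans _ _ (e / 2)) //; last lra.
by rewrite -(@ler_pXn2r _ 2) ?nnegrE ?divr_ge0 ?(ltW e0) ?uN.
Qed.

Lemma sqr_norm_continuous (R : realType) (V : normedModType R) :
  continuous (fun x : V => `|x| ^+ 2).
Proof.
move=> x; rewrite /continuous_at expr2; under eq_fun do rewrite expr2.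
by apply: cvgM; exact: norm_continuous.
Qed.

Section InnerProduct.
Variables (R : realType) (H : normedModType R) (ip : {dot H for (@idfun R)}).
Hypothesis ip_norm : induces_norm ip.

Lemma ipC x z : ip x z = ip z x.
Proof. by rewrite hermC expr0 mul1r. Qed.

Lemma ipDl x z w : ip (x + z) w = ip x w + ip z w.
Proof. exact: linearDl. Qed.

Lemma ipZl a x w : ip (a *: x) w = a * ip x w.
Proof. exact: linearZl_LR. Qed.

Lemma ipDr x z w : ip w (x + z) = ip w x + ip w z.
Proof. by rewrite ipC ipDl !(ipC w). Qed.

Lemma ipZr a x w : ip w (a *: x) = a * ip w x.
Proof. by rewrite ipC ipZl ipC. Qed.

Lemma ipNl x w : ip (- x) w = - ip x w.
Proof. by rewrite -scaleN1r ipZl mulN1r. Qed.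

Lemma ipNr x w : ip w (- x) = - ip w x.
Proof. by rewrite ipC ipNl ipC. Qed.

Definition ipE := (ipDl, ipDr, ipZl, ipZr, ipNl, ipNr).

Lemma ip_ext x z : (forall w, ip w x = ip w z) -> x = z.
Proof.
move=> xz; apply/eqP; rewrite -subr_eq0 -normr_eq0 -sqrf_eq0 -ip_norm.
by rewrite ipDr ipNr xz subrr.
Qed.

(** By polarization the inner product is a polynomial in norms, and norms are
    continuous. *)
Lemma ip_continuous z : continuous (ip^~ z).
Proof.
have -> : ip^~ z =
    (fun x => 2^-1 * (`|x + z| ^+ 2 - `|x| ^+ 2 - `|z| ^+ 2)).
  by apply/funext => x; rewrite -!ip_norm !ipE (ipC z x); field.
move=> x.
apply: cvgMr; apply: cvgB; last exact: cvg_cst.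
apply: cvgB; last exact: sqr_norm_continuous.
apply: (@continuous_cvg _ _ _ _ _ (fun t => t + z) (fun t => `|t| ^+ 2)).
  exact: sqr_norm_continuous.
by apply: cvgD; [exact: cvg_id | exact: cvg_cst].
Qed.

End InnerProduct.

Section Riesz.
Variables (R : realType) (H : completeNormedModType R).
Variable ip : {dot H for (@idfun R)}.
Hypothesis ip_norm : induces_norm ip.

Lemma linear_form_bound (f : H -> R^o) : linear f -> continuous f ->
  exists2 k, 0 <= k & forall x, `|f x| <= k * `|x|.
Proof.
move=> flin fcont.
pose f' : {linear H -> R^o} := HB.pack f (GRing.isLinear.Build _ _ _ _ f flin).
have /linear_boundedP : bounded_near f' (nbhs 0).
  exact/continuous_linear_bounded/fcont.
move=> /pinfty_ex_gt0[k k0 fk]; by exists k; rewrite ?(ltW k0).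
Qed.

(** The functional [J x = <x, x> - 2 f x] is bounded below because [f] is bounded.
    By the parallelogram identity its minimizing sequences are Cauchy, and the
    stationarity of [J] at the limit [w] is the equation [f = <_, w>]. *)
Lemma riesz (f : H -> R^o) : linear f -> continuous f ->
  exists w, forall x, f x = ip x w.
Proof.
move=> flin fcont.
have fD x z : f (x + z) = f x + f z by have := flin 1 x z; rewrite !scale1r.
have f0 : f 0 = 0.
  by have := flin (- 1) 0 0; rewrite scaler0 addr0 scaleN1r addNr.
have fZ a x : f (a *: x) = a * f x.
  by have := flin a x 0; rewrite !addr0 f0 addr0.
have [k k0 fk] := linear_form_bound flin fcont.
pose J x := ip x x - 2 * f x.
have J_lb x : - k ^+ 2 <= J x.
  have := fk x; have := ler_norm (f x); have := sqr_ge0 (`|x| - k).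
  by rewrite /J ip_norm; nra.
have rJ : has_inf (range J).
  by split; [exists (J 0), 0 | exists (- k ^+ 2) => _ [x _ <-]].
pose m := inf (range J).
have mJ x : m <= J x by apply: ge_inf; [exact: rJ.2 | exists x].
have /choice [u Ju] : forall n : nat, exists x, J x < m + n.+1%:R^-1.
  move=> n; have n0 : 0 < n.+1%:R^-1 :> R by rewrite invr_gt0.
  have [_ [x _ <-]] := inf_adherent n0 rJ.
  by exists x.
(* The parallelogram identity, with the value of [J] at the midpoint >= m. *)
have par x z : `|x - z| ^+ 2 <= 2 * (J x - m) + 2 * (J z - m).
  have := mJ (2^-1 *: (x + z)).
  rewrite -ip_norm /J !(ipE, fD, fZ) (ipC _ z x); lra.
have u_cvg : cvgn u.
  apply: cvgn_sqr_cauchy => e e0.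
  have [N _ Ne] := @near_infty_natSinv_lt R (PosNum (divr_gt0 e0 (ltr0Sn R 3))).
  exists N => n Nn; apply: le_trans (par _ _) _.
  have := Ne _ Nn; have := Ne _ (leqnn N); have := Ju n; have := Ju N.
  rewrite /=; move: N.+1%:R^-1 n.+1%:R^-1 (J (u N)) (J (u n)) => p q a b; lra.
have J_cont : continuous J.
  move=> x; rewrite /J; apply: cvgB; last by apply: cvgMr; exact: fcont.
  under eq_fun do rewrite ip_norm; rewrite ip_norm.
  exact: sqr_norm_continuous.
pose w := limn u.
have Jw : J w <= m.
  have Juw : J \o u @ \oo --> J w by apply: continuous_cvg; [exact: J_cont|].
  have mh : (fun n => m + harmonic n) @ \oo --> m + 0.
    by apply: cvgD; [exact: cvg_cst | exact: cvg_harmonic].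
  rewrite -[m]addr0; apply: (ler_cvg_to Juw mh).
  by apply: nearW => n; exact: ltW (Ju n).
exists w => x.
pose r := f x - ip x w.
suff r0 : r ^+ 2 = 0 by apply/eqP; rewrite -subr_eq0 -sqrf_eq0 r0.
(* The step [s * r] along [x] changes [J] by [s * r^2 * (s * |x|^2 - 2)]; with
   this [s] one has [s * |x|^2 < 1], so the change is negative unless [r = 0]. *)
pose s := (1 + ip x x)^-1.
have xx : 0 <= ip x x by rewrite ip_norm sqr_ge0.
have s0 : 0 < s by rewrite invr_gt0; lra.
have sx : s * (1 + ip x x) = 1 by rewrite mulVf // gt_eqF; lra.
have := le_trans Jw (mJ (w + (s * r) *: x)).
rewrite /J !(ipE, fD, fZ) (ipC _ w x).
have -> : f x = r + ip x w by rewrite /r; ring.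
set a := ip w w; set b := ip x w; set q := ip x x in xx sx * => h.
have {}h : 0 <= s * r ^+ 2 * (s * q - 2) by nra.
have r2 := sqr_ge0 r.
have : s * r ^+ 2 * (1 + s) <= 0 by nra.
nra.
Qed.

End Riesz.

(** * Euclidean structure of the data space *)
Section Euclidean.
Variables (R : realType) (l : nat).
Implicit Types u v w : 'rV[R]_l.

Lemma edotC u v : edot u v = edot v u.
Proof. by apply: eq_bigr => i _; rewrite mulrC. Qed.

Lemma edotDl u v w : edot (u + v) w = edot u w + edot v w.
Proof. by rewrite -big_split; apply: eq_bigr => i _; rewrite mxE mulrDl. Qed.

Lemma edotZl a u w : edot (a *: u) w = a * edot u w.
Proof. by rewrite mulr_sumr; apply: eq_bigr => i _; rewrite mxE mulrA. Qed.

Lemma edotDr u v w : edot w (u + v) = edot w u + edot w v.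
Proof. by rewrite edotC edotDl !(edotC w). Qed.

Lemma edotZr a u w : edot w (a *: u) = a * edot w u.
Proof. by rewrite edotC edotZl edotC. Qed.

Lemma edotNl u w : edot (- u) w = - edot u w.
Proof. by rewrite -scaleN1r edotZl mulN1r. Qed.

Lemma edotNr u w : edot w (- u) = - edot w u.
Proof. by rewrite edotC edotNl edotC. Qed.

Definition edotE := (edotDl, edotDr, edotZl, edotZr, edotNl, edotNr).

Lemma edot_ge0 u : 0 <= edot u u.
Proof. by apply: sumr_ge0 => i _; rewrite -expr2 sqr_ge0. Qed.

Lemma sqr_enorm u : enorm u ^+ 2 = edot u u.
Proof. by rewrite /enorm sqr_sqrtr ?edot_ge0. Qed.

Lemma edot_eq0 u : edot u u = 0 -> u = 0.
Proof.
move=> /eqP; rewrite psumr_eq0 => [/allP u0|i _]; last by rewrite -expr2 sqr_ge0.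
apply/rowP => i; have := u0 i (mem_index_enum i).
by rewrite /= -expr2 sqrf_eq0 => /eqP ->; rewrite mxE.
Qed.

Lemma edot_continuous v : continuous (fun u => edot u v).
Proof.
move=> u; rewrite /continuous_at /edot.
have FF := nbhs_filter u.
apply: cvg_big => [|i _]; first exact: add_continuous.
by apply: cvgMl; exact: coord_continuous.
Qed.

Lemma orth_projE (V : set 'rV[R]_l) (y p : 'rV[R]_l) :
  (forall u v, V u -> V v -> V (u - v)) -> is_orth_proj V y p ->
  orth_proj V y = p.
Proof.
move=> VB p_proj; apply: xget_unique => // q [Vq yq].
have [Vp yp] := p_proj; have Vqp := VB _ _ Vq Vp.
apply/eqP; rewrite -subr_eq0; apply/eqP/edot_eq0.
rewrite [X in edot X](_ : q - p = (y - p) - (y - q)); last first.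
  by apply/rowP => i; rewrite !mxE; ring.
by rewrite edotDl edotNl yp ?yq // subr0.
Qed.

Lemma lspan_edot_eq0 (D : set 'rV[R]_l) u :
  (forall v, D v -> edot u v = 0) -> forall v, lspan D v -> edot u v = 0.
Proof.
move=> uD _ [n [a [e [De ->]]]].
elim/big_ind: _ => [|v w v0 w0|i _].
- by rewrite -(scale0r 0) edotZr mul0r.
- by rewrite edotDr v0 w0 addr0.
- by rewrite edotZr uD ?mulr0.
Qed.

End Euclidean.

(** * The Tikhonov functional *)
Section Tikhonov.
Variables (R : realType) (l : nat) (H : completeNormedModType R).
Variable ip : {dot H for (@idfun R)}.
Hypothesis ip_norm : induces_norm ip.
Variable T : {linear H -> 'rV[R]_l}.
Hypothesis T_cont : continuous T.

(** The value of the adjoint at [v] represents the continuous linear form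
    [x |-> <T x, v>]. *)
Lemma adjointP : is_adjoint ip T (adjoint ip T).
Proof.
suff /choice [G TG] : forall v, exists w, forall x, edot (T x) v = ip x w.
  by apply: (xgetPex (fun=> 0)); exists G => x v; exact: TG.
move=> v; apply: (riesz ip_norm) => [a x z|x].
  by rewrite linearP !edotE.
exact: (continuous_comp (@T_cont x) (@edot_continuous _ _ v (T x))).
Qed.

Variables (lambda : R) (y : 'rV[R]_l).
Local Notation num f := (rfmp_num ip T lambda (y - T f) f).
Local Notation den := (rfmp_den T lambda).
Local Notation J := (tikhonov T lambda y).

Lemma rfmp_numD f x z : num f (x + z) = num f x + num f z.
Proof. by rewrite /rfmp_num linearD edotDr (ipDr ip); ring. Qed.

Lemma rfmp_numZ f a x : num f (a *: x) = a * num f x.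
Proof. by rewrite /rfmp_num linearZ edotZr (ipZr ip); ring. Qed.

Lemma rfmp_denZ a x : den (a *: x) = a ^+ 2 * den x.
Proof.
rewrite /rfmp_den linearZ normrZ exprMn !sqr_enorm !edotE.
by rewrite real_normK ?num_real //; ring.
Qed.

(** The second-order Taylor expansion of [J], which is exact as [J] is quadratic.
    The descent of the algorithm, the minimality of the limit and the uniqueness
    of the minimizer are all read off from it. *)
Lemma tikhonovD f g : J (f + g) = J f - 2 * num f g + den g.
Proof.
rewrite /tikhonov /rfmp_num /rfmp_den linearD !sqr_enorm -!ip_norm.
rewrite !edotE !(ipE ip) (ipC ip g f) (edotC (T g) y) (edotC (T g) (T f)).
by rewrite (edotC (T f) y); ring.
Qed.

Lemma rfmp_num_continuous_r f : continuous (num f).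
Proof.
have -> : num f = (fun x => edot (T x) (y - T f) - lambda * ip x f).
  by apply/funext => x; rewrite /rfmp_num edotC (ipC ip).
move=> x; apply: cvgB; last by apply: cvgMr; exact: ip_continuous.
exact: (continuous_comp (@T_cont x) (@edot_continuous _ _ _ (T x))).
Qed.

Lemma rfmp_num_continuous_l x : continuous (fun f => num f x).
Proof.
have -> : (fun f => num f x) =
    (fun f => edot y (T x) - edot (T f) (T x) - lambda * ip f x).
  by apply/funext => f; rewrite /rfmp_num edotDl edotNl.
move=> f.
apply: cvgB; last by apply: cvgMr; exact: ip_continuous.
apply: cvgB; first exact: cvg_cst.
exact: (continuous_comp (@T_cont f) (@edot_continuous _ _ _ (T f))).
Qed.

(** The zero set of the continuous linear form [num f] is a closed subspace. *)
Lemma rfmp_num_dense (D : set H) f : closure (lspan D) = [set: H] ->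
  (forall e, D e -> num f e = 0) -> forall x, num f x = 0.
Proof.
move=> D_dense numD x.
have num_closed : closed [set x | num f x = 0].
  apply: (@preimage_closed _ _ (num f) [set 0]); last exact: closed_eq.
  by move=> z _; exact: rfmp_num_continuous_r.
apply: num_closed.
suff : lspan D `<=` [set x | num f x = 0].
  by move/closureS; apply; rewrite D_dense.
move=> _ [n [a [e [De ->]]]] /=.
elim/big_ind: _ => [|v w v0 w0|i _].
- by rewrite -(scale0r 0) rfmp_numZ mul0r.
- by rewrite rfmp_numD v0 w0 addr0.
- by rewrite rfmp_numZ numD ?mulr0.
Qed.

(** [num f] is the inner product with [T^* y - T^* T f - lambda f]. *)
Lemma normal_equation f : (forall x, num f x = 0) ->
  adjoint ip T (T f) + lambda *: f = adjoint ip T y.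
Proof.
move=> num0; apply: (ip_ext ip_norm) => x.
rewrite !(ipE ip) -!adjointP; have := num0 x.
by rewrite /rfmp_num !edotE (ipC ip f x) (edotC y) (edotC (T f)); lra.
Qed.

Hypothesis lambda_ge0 : 0 <= lambda.

Lemma rfmp_den_ge0 x : 0 <= den x.
Proof. by rewrite addr_ge0 ?sqr_ge0 // mulr_ge0 ?sqr_ge0. Qed.

Lemma tikhonov_ge0 f : 0 <= J f.
Proof. by rewrite addr_ge0 ?sqr_ge0 // mulr_ge0 ?sqr_ge0. Qed.

Lemma tikhonov_min f : (forall x, num f x = 0) -> forall g, J f <= J g.
Proof.
move=> num0 g; rewrite -(subrK f g) addrC tikhonovD num0.
have := rfmp_den_ge0 (g - f); lra.
Qed.

Lemma tikhonov_min_unique f : 0 < lambda -> (forall x, num f x = 0) ->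
  forall g, (forall g', J g <= J g') -> g = f.
Proof.
move=> lambda_gt0 num0 g /(_ f).
rewrite -{1}(subrK f g) addrC tikhonovD num0 => h.
have den0 : lambda * `|g - f| ^+ 2 <= 0.
  by have := sqr_ge0 (enorm (T (g - f))); rewrite /rfmp_den in h; lra.
apply/eqP; rewrite -subr_eq0 -normr_eq0 -sqrf_eq0 eq_le sqr_ge0 andbT.
by rewrite -(pmulr_rle0 _ lambda_gt0).
Qed.

End Tikhonov.

(** * Finite expansions and the semi-frame condition *)
Section SemiFrame.
Variables (R : realType) (H : normedModType R).

(** The semi-frame inequality speaks of convergent infinite expansions; it applies
    to a finite block of one by setting the other coefficients to zero while
    keeping the dictionary elements, so that the multiplicities are unchanged. *)
Lemma semi_frame_sum (D : set H) (c : R) (M : nat) (beta : nat -> R)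
    (e : nat -> H) (n m : nat) : semi_frame D c M -> (n <= m)%N ->
  (forall k, D (e k)) -> (forall k, [set j | e j = e k] #<= `I_M) ->
  c * `|\sum_(n <= k < m) beta k *: e k| ^+ 2 <= \sum_(n <= k < m) beta k ^+ 2.
Proof.
move=> D_frame nm De e_mult.
pose b k := if (n <= k < m)%N then beta k else 0.
have trunc (V : nmodType) (g h : nat -> V) p : (m <= p)%N ->
    (forall k, (n <= k < m)%N -> g k = h k) ->
    (forall k, ~~ (n <= k < m)%N -> g k = 0) ->
    \sum_(0 <= k < p) g k = \sum_(n <= k < m) h k.
  move=> mp gh g0; rewrite (big_cat_nat (leq0n n) (leq_trans nm mp)) /=.
  rewrite (big_cat_nat nm mp) /= [X in X + _]big_nat_cond.
  rewrite big1 => [|k]; last by rewrite andbT => kn; rewrite g0 // leqNgt; lia.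
  rewrite [X in _ + (_ + X)]big_nat_cond [X in _ + (_ + X)]big1 => [|k].
    by rewrite add0r addr0; apply: eq_big_nat.
  by rewrite andbT => kn; rewrite g0 //; lia.
have := D_frame b e (\sum_(n <= k < m) beta k *: e k) De e_mult.
rewrite -lee_fin => frame; apply: le_trans (frame _) _.
  apply: cvg_near_cst; exists m => // p /= mp; rewrite /series /=.
  by apply: trunc => // k nkm; rewrite /b ?nkm // (negbTE nkm) scale0r.
rewrite (nneseries_split 0 m) => [|k _]; last by rewrite lee_fin sqr_ge0.
rewrite eseries0 => [|k mk _]; last first.
  by rewrite /b ifN ?expr0n //; lia.
rewrite adde0 add0n sumEFin lee_fin.
rewrite (trunc _ _ (fun k => beta k ^+ 2)) // => k nkm.
  by rewrite /b nkm.
by rewrite /b (negbTE nkm) expr0n.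
Qed.

End SemiFrame.

(** * Convergence of the matching pursuit *)
Section RFMP.
Variables (R : realType) (l : nat) (H : completeNormedModType R).
Variable ip : {dot H for (@idfun R)}.
Hypothesis ip_norm : induces_norm ip.
Variable T : {linear H -> 'rV[R]_l}.
Hypothesis T_cont : continuous T.
Variable lambda : R.
Hypothesis lambda_ge0 : 0 <= lambda.
Variables (y : 'rV[R]_l) (F0 : H) (D : set H).
Local Notation num f := (rfmp_num ip T lambda (y - T f) f).
Local Notation den := (rfmp_den T lambda).
Local Notation J := (tikhonov T lambda y).

Lemma rfmp_den_lbound : (0 < ereal_inf [set (den d)%:E | d in D])%E ->
  exists2 C, 0 < C & forall e, D e -> C <= den e.
Proof.
move=> inf_gt0.
have inf_den e : D e -> (ereal_inf [set (den d)%:E | d in D] <= (den e)%:E)%E.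
  by move=> De; apply: ereal_inf_lbound; exists e.
(* The infimum is [+oo] when the dictionary is empty. *)
case: (ereal_inf _) inf_gt0 inf_den => [C C0 inf_den|_ inf_den|//].
  by exists C => // e /inf_den; rewrite lee_fin.
by exists 1 => // e /inf_den; rewrite leNgt ltry.
Qed.

Variables (F : nat -> H) (res : nat -> 'rV[R]_l) (d : nat -> H).
Variable alpha : nat -> R.
Hypothesis F_rfmp : rfmp ip T lambda D y F0 F res d alpha.

Lemma rfmp_res n : res n = y - T (F n).
Proof.
case: F_rfmp => F_0 res_0 _ _ _ F_S res_S; elim: n => [|n IH].
  by rewrite res_0 F_0.
by rewrite res_S IH F_S (linearD T) (linearZ_LR T) opprD addrA.
Qed.

Lemma rfmp_series n :
  F n = series (fun k => alpha k.+1 *: d k.+1) n + F0.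
Proof.
case: F_rfmp => F_0 _ _ _ _ F_S _; elim: n => [|n IH].
  by rewrite /series /= big_geq // add0r.
by rewrite F_S IH /series /= big_nat_recr //= addrAC.
Qed.

Variable C : R.
Hypothesis C_gt0 : 0 < C.
Hypothesis den_ge : forall e, D e -> C <= den e.

Lemma rfmp_den_gt0 e : D e -> 0 < den e.
Proof. by move=> De; exact: lt_le_trans (den_ge De). Qed.

(** [alpha n.+1] is the exact line search in the direction [d n.+1], so the gain
    is the very quantity that the choice of [d n.+1] maximizes. *)
Lemma rfmp_gain n : num (F n) (d n.+1) ^+ 2 / den (d n.+1) =
  J (F n) - J (F n.+1).
Proof.
case: (F_rfmp) => _ _ dD _ alphaE F_S _.
have d_gt0 := rfmp_den_gt0 (dD n).
rewrite F_S (tikhonovD ip_norm) rfmp_numZ rfmp_denZ alphaE rfmp_res.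
by field; rewrite gt_eqF.
Qed.

Lemma rfmp_coef_gain n : C * alpha n.+1 ^+ 2 <= J (F n) - J (F n.+1).
Proof.
case: (F_rfmp) => _ _ dD _ alphaE _ _.
have d_gt0 := rfmp_den_gt0 (dD n).
rewrite -rfmp_gain alphaE rfmp_res.
rewrite [leRHS](_ : _ = den (d n.+1) *
    (num (F n) (d n.+1) / den (d n.+1)) ^+ 2); last by field; rewrite gt_eqF.
by rewrite ler_wpM2r ?sqr_ge0 // den_ge.
Qed.

Lemma tikhonov_rfmp_noninc : {homo (J \o F) : n m / (n <= m)%N >-> m <= n}.
Proof.
apply/nonincreasing_seqP => n /=; rewrite -subr_ge0.
by apply: le_trans (rfmp_coef_gain n); rewrite mulr_ge0 ?sqr_ge0 ?ltW.
Qed.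

Lemma tikhonov_rfmp_cvg : cvgn (J \o F).
Proof.
apply: nonincreasing_is_cvgn; first exact: tikhonov_rfmp_noninc.
by exists 0 => _ [n _ <-]; exact: tikhonov_ge0.
Qed.

Lemma rfmp_coef_sum n m : (n <= m)%N ->
  C * \sum_(n <= k < m) alpha k.+1 ^+ 2 <= J (F n) - J (F m).
Proof.
move=> nm; rewrite mulr_sumr -opprB -(telescope_sumr (J \o F) nm) -sumrN.
by apply: ler_sum => k _ /=; rewrite opprB; exact: rfmp_coef_gain.
Qed.

Variables (c : R) (M : nat).
Hypothesis c_gt0 : 0 < c.
Hypothesis D_frame : semi_frame D c M.
Hypothesis d_mult :
  forall e, D e -> [set n | (1 <= n)%N /\ d n = e] #<= `I_M.

Lemma rfmp_shift_mult k : [set j | d j.+1 = d k.+1] #<= `I_M.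
Proof.
case: (F_rfmp) => _ _ dD _ _ _ _.
apply: card_le_trans (d_mult (dD k)).
rewrite -(card_le_eql (inj_card_eq (f := succn) _)); last by move=> i j _ _ [].
by apply: subset_card_le => _ [j jk <-].
Qed.

(** For [N <= m], the semi-frame inequality on the block [N <= k < m] and the
    summability of the squared coefficients give
    [C c |S m - S N|^2 <= J (F N) - J (F m)], and [J (F n)] converges. *)
Lemma rfmp_series_cvg : cvgn (series (fun k => alpha k.+1 *: d k.+1)).
Proof.
case: (F_rfmp) => _ _ dD _ _ _ _.
apply: cvgn_sqr_cauchy => e e0.
have Cce : 0 < C * c * e by rewrite !mulr_gt0.
have /cvgrPdist_le /(_ _ Cce) [N _ JN] := tikhonov_rfmp_cvg.
exists N => m Nm.
have -> : series (fun k => alpha k.+1 *: d k.+1) m -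
    series (fun k => alpha k.+1 *: d k.+1) N =
    \sum_(N <= k < m) alpha k.+1 *: d k.+1.
  by rewrite /series /= (big_cat_nat (leq0n N) Nm) /= addrAC subrr add0r.
have frame := @semi_frame_sum _ _ _ _ _ (fun k => alpha k.+1)
  (fun k => d k.+1) _ _ D_frame Nm dD rfmp_shift_mult.
have coef := rfmp_coef_sum Nm.
have JN_lim := JN N (leqnn N).
have Jm_ge := nonincreasing_cvgn_ge tikhonov_rfmp_noninc tikhonov_rfmp_cvg m.
rewrite -(ler_pM2l (mulr_gt0 C_gt0 c_gt0)) -mulrA.
have := ler_wpM2l (ltW C_gt0) frame.
move: JN_lim; rewrite /= distrC => /(le_trans (ler_norm _)).
rewrite /= in Jm_ge *; lra.
Qed.

Lemma rfmp_cvg :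
  F @ \oo --> limn (series (fun k => alpha k.+1 *: d k.+1)) + F0.
Proof.
rewrite (_ : F = fun n => series (fun k => alpha k.+1 *: d k.+1) n + F0).
  by apply: cvgD; [exact: rfmp_series_cvg | exact: cvg_cst].
by apply/funext => n; exact: rfmp_series.
Qed.

(** The gain in step [n] dominates [num (F n) e ^+ 2 / den e] for each [e] in the
    dictionary, and it tends to 0 as [J (F n)] converges. *)
Lemma rfmp_limit_num f : F @ \oo --> f -> forall e, D e -> num f e = 0.
Proof.
case: (F_rfmp) => _ _ _ dmax _ _ _ Ff e De.
have e_gt0 := rfmp_den_gt0 De.
have gain0 : (fun n => J (F n) - J (F n.+1)) @ \oo --> (0 : R).
  rewrite -(subrr (limn (J \o F))); apply: cvgB; first exact: tikhonov_rfmp_cvg.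
  by rewrite (cvg_shiftS (J \o F)); exact: tikhonov_rfmp_cvg.
have num_cvg : (fun n => num (F n) e) @ \oo --> num f e.
  have num_cont := rfmp_num_continuous_l ip_norm T_cont
    (lambda := lambda) (y := y) (x := e).
  exact: (continuous_cvg _ (num_cont f) Ff).
have num2_cvg : (fun n => num (F n) e * num (F n) e / den e) @ \oo -->
    num f e * num f e / den e.
  by apply: cvgMl; apply: cvgM.
have : num f e * num f e / den e <= 0.
  apply: (ler_cvg_to num2_cvg gain0); apply: nearW => n.
  by rewrite -expr2 -rfmp_gain -!rfmp_res; exact: dmax.
rewrite pmulr_lle0 ?invr_gt0 // -expr2 => num_le0.
by apply/eqP; rewrite -sqrf_eq0 eq_le num_le0 sqr_ge0.
Qed.

End RFMP.

(** * The limit and the regularized normal equation *)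

Theorem theorem4 (R : realType) (H : completeNormedModType R)
    (ip : {dot H for (@idfun R)}) (ip_norm : induces_norm ip)
    (H_separable : separable H) (H_infdim : infinite_dimensional H)
    (l : nat) (y : 'rV[R]_l)
    (T : {linear H -> 'rV[R]_l}) (T_cont : continuous T)
    (lambda : R) (lambda_ge0 : 0 <= lambda) (F0 : H)
    (D : set H) (D_neq0 : D `<=` ~` [set 0])
    (c : R) (c_gt0 : 0 < c) (M : nat) (D_semi_frame : semi_frame D c M)
    (C1_gt0 : (0 < ereal_inf [set (rfmp_den T lambda d)%:E | d in D])%E)
    (F : nat -> H) (res : nat -> 'rV[R]_l) (d : nat -> H) (alpha : nat -> R)
    (F_rfmp : rfmp ip T lambda D y F0 F res d alpha)
    (d_mult : forall e, D e -> [set n | (1 <= n)%N /\ d n = e] #<= `I_M) :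
  let S := series (fun k => alpha k.+1 *: d k.+1) in
  let Finf := limn S + F0 in
  [/\ cvgn S /\ F @ \oo --> Finf,
      closure (lspan D) = [set: H] ->
      (ereal_sup [set `|e|%:E | e in D] < +oo)%E ->
      [/\ adjoint ip T (T Finf) + lambda *: Finf = adjoint ip T y,
          forall G, tikhonov T lambda y Finf <= tikhonov T lambda y G &
          0 < lambda ->
          forall G, (forall G', tikhonov T lambda y G <= tikhonov T lambda y G') ->
          G = Finf] &
      lspan [set T e | e in D] = range T -> lambda = 0 ->
      T Finf = orth_proj (range T) y].
Proof.
have [C C_gt0 den_ge] := rfmp_den_lbound C1_gt0.
have S_cvg := rfmp_series_cvg ip_norm lambda_ge0 F_rfmp C_gt0 den_ge c_gt0
  D_semi_frame d_mult.
have F_cvg := rfmp_cvg ip_norm lambda_ge0 F_rfmp C_gt0 den_ge c_gt0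
  D_semi_frame d_mult.
move=> S Finf.
have num_D :=
  rfmp_limit_num ip_norm T_cont lambda_ge0 F_rfmp C_gt0 den_ge F_cvg.
split=> [//|D_dense _|ran_D lambda0].
  have num0 := rfmp_num_dense ip_norm T_cont D_dense num_D.
  split=> [|G|lambda_gt0 G].
  - exact: (normal_equation ip_norm T_cont num0).
  - exact: (tikhonov_min ip_norm lambda_ge0 num0).
  - exact: (tikhonov_min_unique ip_norm lambda_gt0 num0).
apply/esym/orth_projE => [_ _ [x _ <-] [z _ <-]|].
  by exists (x - z); rewrite ?linearB.
split; first by exists Finf.
rewrite -ran_D; apply: lspan_edot_eq0 => _ [e De <-].
by have := num_D e De; rewrite /rfmp_num lambda0 mul0r subr0.
Qed.
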